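(* Let $q$ be a power of an odd prime with $q\equiv3\pmod4$, let $d=4k+2$ with $k$ a positive integer, let $S_0=\{x\in\mathbb F_q^d: x_1^2+\cdots+x_d^2=0\}$, $A\subset S_0$ and $B\subset\mathbb F_q^d$. If $|A||B|\ge16q^d$ and either $|A|\le q^{(d-1)/2}$ or $|A|\ge q^{d/2}$, then $|\Delta(A,B)|\ge q/144$.
   Context: $\|x-y\|=\sum_{i}(x_i-y_i)^2$ and $\Delta(A,B)=\{\|a-b\|:a\in A,b\in B\}$. *)

(* Defs.v *)
From HB Require Import structures.
From mathcomp Require Import all_boot all_order all_algebra all_field.
Set Implicit Arguments. Unset Strict Implicit. Unset Printing Implicit Defensive.
Import Order.TTheory GRing.Theory.
Local Open Scope ring_scope.

Definition sqnorm (F : finFieldType) (d : nat) (x : 'rV[F]_d) : F :=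
  \sum_(i < d) (x 0 i) ^+ 2.

Definition S0 (F : finFieldType) (d : nat) : {set 'rV[F]_d} :=
  [set x | sqnorm x == 0].

Definition Delta (F : finFieldType) (d : nat) (A B : {set 'rV[F]_d}) : {set F} :=
  [set sqnorm (a - b) | a in A, b in B].

(* Main.v *)
Require Import Defs.
From HB Require Import structures.
From mathcomp Require Import all_boot all_order all_algebra all_field.
From mathcomp Require Import all_fingroup all_character zify ring.

(** Write [d = 2 m] with [m] odd and let [e] be a nontrivial additive character.
    By Cauchy-Schwarz and Parseval, [q (|A| |B|)^2] is at most [|Delta A B|] times
    the sum over [s] of [|N s|^2], where [N s] is the sum of [e (s |a - b|)] over
    [A x B]; the term [s = 0] is [(|A| |B|)^2], so it suffices to bound the sum over
    [s != 0] by [17 q^d |A| |B|]. Since [q] is 3 mod 4 and [m] is odd, the sum of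
    squares has minus type, and the Fourier transform of its cone [S0] takes a
    negative value at nonzero isotropic vectors.

    If [|A| >= q^m], shrink [B] to at most [16 q^m] points, apply Cauchy-Schwarz in [a]
    and extend the sum from [A] to [S0]: the Fourier transform of [S0] gives the bound.

    If [|A| <= q^m], the sum is at most [q^(1-d)] times the sum over [r] of
    [M_A r * M_B r], where [M_A r] is the sum of the squared Fourier transform of [A]
    over the sphere of radius [r], and one shows [M_A r <= 3 q^(d-1) |A|]. For [r = 0]
    this is the negative sign again; for [r != 0] it follows from a second
    Cauchy-Schwarz over [S0]. *)

Section DistanceSets.
Set Implicit Arguments. Unset Strict Implicit. Unset Printing Implicit Defensive.
Import Order.TTheory GRing.Theory Num.Theory.
Local Open Scope ring_scope.

(** * Additive characters of a finite field *)

Record additive_character (F : finFieldType) (e : F -> algC) : Prop := {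
  char0 : e 0 = 1;
  charD : forall x y, e (x + y) = e x * e y;
  charN : forall x, e (- x) = (e x)^*;
  char_sum : \sum_x e x = 0 }.

(** The additive group is abelian of order above 1, so its irreducible characters are linear and one
    is nontrivial. Translating by [x0], where that character is not 1, multiplies its sum by a
    factor other than 1, so the sum vanishes. *)
Lemma additive_character_exists (F : finFieldType) :
  exists e : F -> algC, additive_character e.
Proof.
have abF : abelian [set: F] by apply: FinRing.zmod_abelian.
have lin (i : Iirr [set: F]) : 'chi_i \is a linear_char by apply/char_abelianP.
have lt1 : (1 < Nirr [set: F])%N.
  by rewrite NirrE card_classes_abelian in abF *; rewrite (eqP abF) cardsT finNzRing_gt1.
pose i : Iirr [set: F] := Ordinal lt1.
have chiM x y : 'chi_i (x + y) = 'chi_i x * 'chi_i y.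
  by rewrite -(lin_charM (lin i)) ?inE.
have [x0 nx0] : exists x0, 'chi_i x0 != 1.
  apply/existsP; apply: contraT; rewrite negb_exists => /forallP H.
  suff /eqP : 'chi_i = 1 by rewrite irr_eq1.
  by apply/cfun_inP => x Gx; rewrite cfun1E Gx; apply/eqP; rewrite -[_ == _]negbK.
exists 'chi_i; split=> // [|x|].
- exact: lin_char1 (lin i).
- by rewrite -(lin_charV_conj (lin i)) ?inE.
apply: (mulfI (_ : 'chi_i x0 - 1 != 0)); first by rewrite subr_eq0.
rewrite mulr0 mulrBl mul1r mulr_sumr; apply/eqP; rewrite subr_eq0; apply/eqP.
rewrite [RHS](reindex_inj (addrI x0)) /=.
by apply: eq_bigr => x _; rewrite chiM.
Qed.

(** * Quadratic Gauss sums *)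

Definition dotp (F : finFieldType) (d : nat) (x y : 'rV[F]_d) : F :=
  \sum_i x 0 i * y 0 i.

Lemma sum_rV_prod (F : finFieldType) (d : nat) (R : comNzRingType)
    (f : 'I_d -> F -> R) :
  \sum_(x : 'rV[F]_d) \prod_i f i (x 0 i) = \prod_i \sum_t f i t.
Proof.
rewrite bigA_distr_bigA /= (reindex (fun g : {ffun 'I_d -> F} => \row_i g i)) /=.
  by apply: eq_bigr => g _; apply: eq_bigr => i _; rewrite mxE.
exists (fun x : 'rV[F]_d => [ffun i => x 0 i]) => [g _|x _].
  by apply/ffunP => i; rewrite ffunE mxE.
by apply/rowP => i; rewrite mxE ffunE.
Qed.

Section Dotp.
Variables (F : finFieldType) (d : nat).
Implicit Types x y z : 'rV[F]_d.

Lemma dotpC x y : dotp x y = dotp y x.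
Proof. by apply: eq_bigr => i _; rewrite mulrC. Qed.

Lemma dotpDl x y z : dotp (x + y) z = dotp x z + dotp y z.
Proof. by rewrite -big_split /=; apply: eq_bigr => i _; rewrite mxE mulrDl. Qed.

Lemma dotpZl c x z : dotp (c *: x) z = c * dotp x z.
Proof. by rewrite mulr_sumr; apply: eq_bigr => i _; rewrite mxE mulrA. Qed.

Lemma dotpBl x y z : dotp (x - y) z = dotp x z - dotp y z.
Proof. by rewrite -scaleN1r dotpDl dotpZl mulN1r. Qed.

Lemma dotpBr x y z : dotp x (y - z) = dotp x y - dotp x z.
Proof. by rewrite !(dotpC x) dotpBl. Qed.

Lemma dotp0l x : dotp 0 x = 0.
Proof. by rewrite -(scale0r x) dotpZl mul0r. Qed.

Lemma sqnormE x : sqnorm x = dotp x x.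
Proof. by apply: eq_bigr => i _; rewrite expr2. Qed.

Lemma sqnormZ c x : sqnorm (c *: x) = c ^+ 2 * sqnorm x.
Proof. by rewrite !sqnormE dotpZl dotpC dotpZl mulrA -expr2. Qed.

Lemma sqnorm0 : sqnorm (0 : 'rV[F]_d) = 0.
Proof. by rewrite sqnormE dotp0l. Qed.

Lemma sqnormB x y : sqnorm (x - y) = sqnorm x - 2 * dotp x y + sqnorm y.
Proof. by rewrite !sqnormE dotpBl !dotpBr (dotpC y x); ring. Qed.

End Dotp.

Section QuadraticGaussSum.
Variable (F : finFieldType).
Hypothesis F3 : (#|F| %% 4 = 3)%N.

Lemma natf2_neq0 : (2 : F) != 0.
Proof.
apply/eqP => F2.
have c2 : 2%N \in [pchar F] by rewrite inE /= F2 eqxx.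
move: F3; rewrite (card_pprimeChar c2 : #|F| = _).
by case: logn => [|[|r]] //; rewrite !expnS mulnA modnMr.
Qed.

Lemma natf4_neq0 : (4 : F) != 0.
Proof. by rewrite (_ : 4 = 2 * 2) ?mulf_neq0 ?natf2_neq0 // -natrM. Qed.

(** As [#|F|] is 4j + 3, the exponent [2 * j + 1] below is half of [#|F|] - 1. *)
Let j := (#|F| %/ 4)%N.

(* The quadratic character of [F]: it is odd because [#|F|] is 3 mod 4, which
   makes [psi x = chi x * x ^+ 2] a bijection of [F]. *)
Let chi (x : F) := x ^+ (2 * j + 1).

Let chi_sqr x : x != 0 -> chi x ^+ 2 = 1.
Proof.
move=> nx; apply: (mulfI nx); rewrite mulr1 -exprM -exprS -[RHS]expf_card.
by congr (_ ^+ _); rewrite [RHS](divn_eq _ 4) F3 -/j; lia.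
Qed.

Let chiN x : chi (- x) = - chi x.
Proof. by rewrite /chi exprNn -signr_odd oddD oddM /= expr1 mulN1r. Qed.

Let chi_sgn x : x != 0 -> chi x = 1 \/ chi x = -1.
Proof.
by move=> /chi_sqr /eqP; rewrite sqrf_eq1 => /orP[] /eqP ->; [left|right].
Qed.

Let psi (x : F) := chi x * x ^+ 2.

(** Since [chi (psi x) = chi x], equal values of [psi] come from arguments with the same [chi] and
    the same square; opposite arguments are then excluded because [chi] is odd. *)
Let psi_inj : injective psi.
Proof.
have psiX x : x != 0 -> chi (psi x) = chi x.
  move=> nx; transitivity (chi (chi x) * chi x ^+ 2).
    by rewrite {1}/chi /psi exprMn [(x ^+ 2) ^+ _]exprAC.
  by rewrite chi_sqr // mulr1; case: (chi_sgn nx) => ->; rewrite ?chiN /chi !expr1n.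
have psi0 x : (psi x == 0) = (x == 0).
  by rewrite /psi /chi -exprD expf_eq0 addn_gt0 orbT.
move=> x y; have [->|nx] := eqVneq x 0.
  by move=> /esym/eqP; rewrite {2}/psi expr0n mulr0 psi0 => /eqP.
have [->|ny] := eqVneq y 0; first by move/eqP; rewrite {2}/psi expr0n mulr0 psi0 => /eqP.
move=> exy; have /= := congr1 chi exy; rewrite !psiX // => cxy.
move/eqP: exy; rewrite /psi cxy (inj_eq (mulfI _)); last first.
  by rewrite /chi expf_neq0.
rewrite eqf_sqr => /orP[] /eqP // xy.
have /eqP : 2 * chi y = 0 by rewrite mulr_natl mulr2n -{1}cxy xy chiN addNr.
by rewrite mulf_eq0 (negPf natf2_neq0) expf_eq0 (negPf ny) andbF.
Qed.

Variables (e : F -> algC) (he : additive_character e).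

Let e0 := char0 he.
Let eD := charD he.
Let eN := charN he.
Let q : algC := #|F|%:R.

Lemma char_sumM x : \sum_s e (s * x) = (x == 0)%:R * q.
Proof.
have [->|nx] := eqVneq x 0.
  under eq_bigr do rewrite mulr0 e0.
  by rewrite sumr_const mul1r.
by rewrite mul0r -[RHS](char_sum he) [RHS](reindex_inj (mulIf nx)).
Qed.

Lemma char_sumM_neq0 x : \sum_(s | s != 0) e (s * x) = (x == 0)%:R * q - 1.
Proof. by rewrite -char_sumM [in RHS](bigD1 0) //= mul0r e0 addrAC subrr add0r. Qed.

Lemma sum_inv_neq0 (f : F -> algC) :
  \sum_(s | s != 0) f (s^-1) = \sum_(s | s != 0) f s.
Proof.
rewrite [RHS](reindex_inj (@invr_inj F)) /=.
by apply: eq_bigl => s; rewrite invr_eq0.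
Qed.

(** For each [x], the values of [e] at [s * x ^+ 2] and its opposite are, in some order, those at
    [s * psi x] and its opposite. Both of the latter sum to 0 as [psi] is a bijection, so the
    conjugate [G'] of [G] is [- G], while [G * G' = q]. *)
Lemma gauss_sum_sqr s : s != 0 -> (\sum_x e (s * x ^+ 2)) ^+ 2 = - q.
Proof.
move=> ns; set G := \sum_x _; pose G' := \sum_x e (- (s * x ^+ 2)).
have GG' : G * G' = q.
  rewrite mulr_suml; under eq_bigr do rewrite mulr_sumr.
  rewrite exchange_big /=.
  (* After the substitution x = y + u the phase is linear in [y], and summing over [y] leaves only
     [u = 0]. *)
  transitivity (\sum_y \sum_u e (s * u ^+ 2) * e (y * (2 * s * u))).
    apply: eq_bigr => y _; rewrite (reindex_inj (addrI y)) /=.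
    by apply: eq_bigr => u _; rewrite -!eD; congr e; ring.
  rewrite exchange_big /=; under eq_bigr do rewrite -mulr_sumr char_sumM.
  rewrite (bigD1 0) //= big1 => [|u nu].
    by rewrite expr0n !mulr0 e0 eqxx !mul1r addr0.
  by rewrite !mulf_eq0 (negPf natf2_neq0) (negPf ns) (negPf nu) mul0r mulr0.
have G'E : G + G' = 0.
  have S1 : \sum_x e (s * psi x) = 0.
    transitivity (\sum_x e (x * s)); last by rewrite char_sumM (negPf ns) mul0r.
    by rewrite [RHS](reindex_inj psi_inj); apply: eq_bigr => x _; rewrite mulrC.
  have S2 : \sum_x e (- (s * psi x)) = 0.
    rewrite -[RHS]S1 [RHS](reindex_inj (@oppr_inj F)); apply: eq_bigr => x _.
    by rewrite /psi chiN sqrrN mulNr mulrN.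
  rewrite -[RHS](addr0 0) -[X in _ = X + _]S1 -[X in _ = _ + X]S2 -!big_split /=.
  apply: eq_bigr => x _; have [->|nx] := eqVneq x 0.
    by rewrite /psi expr0n !mulr0 oppr0.
  by rewrite /psi; case: (chi_sgn nx) => ->; rewrite ?mul1r // mulN1r mulrN opprK addrC.
by rewrite -GG' -(addr0_eq G'E) mulrN opprK expr2.
Qed.
End QuadraticGaussSum.

(** * Fourier transforms of spheres and of the cone *)

Lemma cauchy_schwarz (I : finType) (P : pred I) (x y : I -> algC) :
  `|\sum_(i | P i) x i * y i| ^+ 2
    <= (\sum_(i | P i) `|x i| ^+ 2) * \sum_(i | P i) `|y i| ^+ 2.
Proof.
set p := \sum_(i | P i) _ * _; set X := \sum_(i | P i) _; set Y := \sum_(i | P i) _.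
have Yge0 : 0 <= Y by apply: sumr_ge0 => i _; rewrite exprn_ge0.
have [Y0|nY] := eqVneq Y 0.
  have y0 i : P i -> y i = 0.
    move=> Pi; apply/eqP; rewrite -normr_eq0 -sqrf_eq0; apply/eqP/le_anti.
    rewrite exprn_ge0 // andbT -Y0 /Y (bigD1 i) //= lerDl.
    by apply: sumr_ge0 => k _; rewrite exprn_ge0.
  rewrite [p]big1 => [|i Pi]; last by rewrite y0 // mulr0.
  by rewrite normr0 expr0n Y0 mulr0.
have YY : Y^* = Y by apply/CrealP/ger0_real.
(* Up to the factor [Y], this vector is the part of [x] orthogonal to the conjugate of [y]. *)
have : 0 <= \sum_(i | P i) `|Y * x i - p * (y i)^*| ^+ 2.
  by apply: sumr_ge0 => i _; rewrite exprn_ge0.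
have -> : \sum_(i | P i) `|Y * x i - p * (y i)^*| ^+ 2 = Y * (Y * X - `|p| ^+ 2).
  transitivity (\sum_(i | P i) (Y ^+ 2 * `|x i| ^+ 2 + (- (Y * p^*)) * (x i * y i)
      + ((- (Y * p)) * (x i * y i)^* + p * p^* * `|y i| ^+ 2))).
    by apply: eq_bigr => i _; rewrite !normCK rmorphB !rmorphM /= conjCK YY; ring.
  rewrite !big_split /= -!mulr_sumr -rmorph_sum -/p -/X -/Y normCK; ring.
rewrite pmulr_rge0 ?lt0r ?nY //.
by rewrite subr_ge0 mulrC.
Qed.

Lemma cauchy_schwarz_card (I : finType) (A : {set I}) (y : I -> algC) :
  `|\sum_(i in A) y i| ^+ 2 <= #|A|%:R * \sum_(i in A) `|y i| ^+ 2.
Proof.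
have := cauchy_schwarz (mem A) (fun=> 1) y.
under eq_bigr do rewrite mul1r; under [X in _ <= X * _]eq_bigr do rewrite normr1 expr1n.
by rewrite sumr_const.
Qed.

Section FourierTransform.
Variable (F : finFieldType).
Hypothesis F3 : (#|F| %% 4 = 3)%N.
Variables (e : F -> algC) (he : additive_character e).

Let e0 := char0 he.
Let eD := charD he.
Let eN := charN he.
Let q : algC := #|F|%:R.

Lemma char_bigsum (I : finType) (f : I -> F) : e (\sum_i f i) = \prod_i e (f i).
Proof. exact: big_morph. Qed.

Lemma sqr_norm_char_sum (I : finType) (P : pred I) (f : I -> F) :
  `|\sum_(i | P i) e (f i)| ^+ 2 = \sum_(i | P i) \sum_(j | P j) e (f i - f j).
Proof.
rewrite normCK rmorph_sum mulr_suml /=; apply: eq_bigr => i _.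
by rewrite mulr_sumr; apply: eq_bigr => j _; rewrite eD eN.
Qed.

Lemma char_parseval (g : F -> algC) :
  \sum_s `|\sum_t e (s * t) * g t| ^+ 2 = q * \sum_t `|g t| ^+ 2.
Proof.
transitivity (\sum_t \sum_t' (g t * (g t')^*) * \sum_s e (s * (t - t'))).
  rewrite (eq_bigr (fun s => \sum_t \sum_t' (g t * (g t')^*) * e (s * (t - t')))).
    rewrite exchange_big; apply: eq_bigr => t _ /=; rewrite exchange_big.
    by apply: eq_bigr => t' _; rewrite mulr_sumr.
  move=> s _; rewrite normCK rmorph_sum mulr_suml /=; apply: eq_bigr => t _.
  rewrite mulr_sumr; apply: eq_bigr => t' _.
  by rewrite rmorphM /= mulrBr eD eN; ring.
rewrite mulr_sumr; apply: eq_bigr => t _; under eq_bigr do rewrite (char_sumM he).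
rewrite (bigD1 t) //= big1 => [|t' nt]; last by rewrite subr_eq0 eq_sym (negPf nt) mul0r mulr0.
by rewrite subrr eqxx addr0 mul1r -normCK mulrC.
Qed.

Section Space.
Variable d : nat.
Implicit Types (v x : 'rV[F]_d) (A B : {set 'rV[F]_d}).

Lemma char_sum_dotp v : \sum_x e (dotp v x) = (v == 0)%:R * q ^+ d.
Proof.
under eq_bigr do rewrite char_bigsum.
rewrite (sum_rV_prod (fun i t => e (v 0 i * t))).
under eq_bigr => i _ do (under eq_bigr do rewrite mulrC; rewrite (char_sumM he)).
have [->|] := eqVneq v 0.
  by under eq_bigr do rewrite mxE eqxx mul1r; rewrite prodr_const card_ord mul1r.
move=> nv; rewrite mul0r; apply/eqP; apply: contraNT nv => /prodf_neq0 H.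
apply/eqP/rowP => i; rewrite mxE; apply/eqP.
by apply: contraR (H i isT) => /negPf vi0; rewrite vi0 mul0r eqxx.
Qed.

Lemma parseval_set B :
  \sum_x `|\sum_(b in B) e (dotp x b)| ^+ 2 = q ^+ d * #|B|%:R.
Proof.
under eq_bigr do rewrite sqr_norm_char_sum.
rewrite exchange_big /= mulr_natr -sumr_const; apply: eq_bigr => b Bb.
rewrite exchange_big /= (bigD1 b) //= [X in _ + X]big1 => [|c /andP[_ ncb]].
  by under eq_bigr do rewrite subrr e0; rewrite sumr_const card_mx mul1n addr0 natrX.
under eq_bigr do rewrite -dotpBr dotpC; rewrite char_sum_dotp.
by rewrite subr_eq0 eq_sym (negPf ncb) mul0r.
Qed.

Variable m : nat.
Hypotheses (dE : d = m.*2) (om : odd m).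

(* The sign of [- q ^+ m] reflects that the form is of minus type. *)
Lemma char_sum_sqnorm s v : s != 0 ->
  \sum_x e (s * sqnorm x + dotp v x) = - q ^+ m * e (- (sqnorm v / (4 * s))).
Proof.
move=> ns.
transitivity (\sum_(x : 'rV[F]_d) \prod_i e (s * (x 0 i) ^+ 2 + v 0 i * x 0 i)).
  apply: eq_bigr => x _; rewrite -char_bigsum; congr e.
  by rewrite big_split /= mulr_sumr.
rewrite (sum_rV_prod (fun i t => e (s * t ^+ 2 + v 0 i * t))).
transitivity (\prod_i (e (- ((v 0 i) ^+ 2 / (4 * s))) * \sum_t e (s * t ^+ 2))).
  (* The shift completes the square. *)
  apply: eq_bigr => i _; rewrite (reindex_inj (addIr (- (v 0 i / (2 * s))))) /=.
  rewrite mulr_sumr; apply: eq_bigr => t _; rewrite -eD; congr e.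
  by field; rewrite ns natf2_neq0 ?natf4_neq0.
rewrite big_split /= -char_bigsum prodr_const card_ord mulrC; congr (_ * e _).
  rewrite dE -muln2 mulnC exprM (gauss_sum_sqr F3 he ns) exprNn -signr_odd om expr1.
  by rewrite mulN1r.
by rewrite sumrN mulr_suml.
Qed.

(** The sphere is detected by summing [e (s * (sqnorm x - r))] over all [s]: [s = 0] gives the first
    term, and [char_sum_sqnorm] the others. *)
Lemma sphere_fourier r v :
  q * \sum_(x | sqnorm x == r) e (dotp v x) = (v == 0)%:R * q ^+ d
    - q ^+ m * \sum_(s | s != 0) e (- (s * r) - sqnorm v / (4 * s)).
Proof.
transitivity (\sum_s e (- (s * r)) * \sum_x e (s * sqnorm x + dotp v x)).
  under [RHS]eq_bigr do rewrite mulr_sumr.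
  rewrite exchange_big /= mulr_sumr big_mkcond; apply: eq_bigr => x _ /=.
  transitivity (\sum_s e (s * (sqnorm x - r)) * e (dotp v x)).
    rewrite -mulr_suml (char_sumM he) subr_eq0.
    by case: eqP; rewrite ?mul1r ?mul0r.
  by apply: eq_bigr => s _; rewrite -!eD; congr e; ring.
rewrite (bigD1 0) //=; congr (_ + _).
  rewrite mul0r oppr0 e0 mul1r -char_sum_dotp.
  by apply: eq_bigr => x _; rewrite mul0r add0r.
rewrite mulr_sumr -sumrN; apply: eq_bigr => s ns.
by rewrite char_sum_sqnorm // eD; ring.
Qed.

(** For [r = 0], inverting [s] turns the sum over [s] into a complete character sum less one term,
    so no Kloosterman sum remains. *)
Lemma cone_fourier v :
  q * \sum_(x in S0 F d) e (dotp v x) =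
  (v == 0)%:R * q ^+ d - q ^+ m * ((sqnorm v == 0)%:R * q - 1).
Proof.
rewrite (eq_bigl (fun x => sqnorm x == 0)) => [|x]; last by rewrite inE.
rewrite sphere_fourier; congr (_ - _ * _).
have -> : (sqnorm v == 0) = (- (sqnorm v / 4) == 0).
  by rewrite oppr_eq0 mulf_eq0 invr_eq0 (negPf (natf4_neq0 F3)) orbF.
rewrite -(char_sumM_neq0 he) -sum_inv_neq0; apply: eq_bigr => s ns.
by congr e; rewrite mulr0 oppr0 add0r; field; rewrite ns natf4_neq0.
Qed.

End Space.
End FourierTransform.

(** * Distance sums *)

Section DistanceSums.
Variable (F : finFieldType).
Hypothesis F3 : (#|F| %% 4 = 3)%N.
Variables (e : F -> algC) (he : additive_character e).

Let e0 := char0 he.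
Let eD := charD he.
Let eN := charN he.
Let q : algC := #|F|%:R.

Let q_ge0 : 0 <= q. Proof. exact: ler0n. Qed.

Let q_ge1 : 1 <= q.
Proof. by rewrite ler1n; apply/card_gt0P; exists 0. Qed.

Let q_gt0 : 0 < q. Proof. exact: lt_le_trans q_ge1. Qed.

Definition dist_sum (d : nat) (A B : {set 'rV[F]_d}) (s : F) : algC :=
  \sum_(a in A) \sum_(b in B) e (s * sqnorm (a - b)).

Section Space.
Variable d : nat.
Implicit Types (v x : 'rV[F]_d) (A B : {set 'rV[F]_d}).

(** [dist_sum A B] is the Fourier transform of [nu], which counts the pairs at each distance.
    Parseval applies to [nu], and Cauchy-Schwarz to its sum over its support [Delta A B]. *)
Lemma card_Delta_dist_sum A B :
  q * (#|A|%:R * #|B|%:R) ^+ 2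
    <= #|Delta A B|%:R * \sum_s `|dist_sum A B s| ^+ 2.
Proof.
pose nu t : algC := \sum_(a in A) \sum_(b in B) (sqnorm (a - b) == t)%:R.
have nuD : \sum_(t in Delta A B) nu t = #|A|%:R * #|B|%:R.
  rewrite exchange_big /= mulr_natl -sumr_const; apply: eq_bigr => a Aa.
  rewrite exchange_big /= -sumr_const; apply: eq_bigr => b Bb.
  rewrite (bigD1 (sqnorm (a - b))) /=; last by apply/imset2P; exists a b.
  by rewrite eqxx big1 ?addr0 // => t /andP[_]; rewrite eq_sym => /negPf ->.
have -> : \sum_s `|dist_sum A B s| ^+ 2 = q * \sum_t `|nu t| ^+ 2.
  rewrite -(char_parseval he); apply: eq_bigr => s _; congr (`| _ | ^+ 2).
  under [RHS]eq_bigr do rewrite mulr_sumr.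
  rewrite exchange_big /=; apply: eq_bigr => a _.
  under [RHS]eq_bigr do rewrite mulr_sumr.
  rewrite exchange_big /=; apply: eq_bigr => b _.
  rewrite (bigD1 (sqnorm (a - b))) //= eqxx mulr1 big1 ?addr0 // => t.
  by rewrite eq_sym => /negPf ->; rewrite mulr0.
rewrite [leRHS]mulrCA ler_wpM2l // -nuD.
have := cauchy_schwarz_card (Delta A B) nu.
rewrite ger0_norm; last by do 3![apply: sumr_ge0 => ? _].
move/le_trans; apply; rewrite ler_wpM2l // [leRHS](bigID (mem (Delta A B))) /= lerDl.
by apply: sumr_ge0 => t _; rewrite exprn_ge0.
Qed.

Variable m : nat.
Hypotheses (dE : d = m.*2) (om : odd m).

(** On the cone [sqnorm x] is 0, so squaring [N s x] leaves phases linear in [x], and [cone_fourier]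
    evaluates their sum over [S0]. *)
Lemma dist_sum_le_right A B : A \subset S0 F d ->
  q * \sum_(s | s != 0) `|dist_sum A B s| ^+ 2
    <= #|A|%:R * (q ^+ d.+1 * #|B|%:R + q ^+ m.+1 * #|B|%:R ^+ 2).
Proof.
move=> /subsetP sA.
pose N s x := \sum_(b in B) e (s * sqnorm (x - b)).
have leN s : `|dist_sum A B s| ^+ 2 <= #|A|%:R * \sum_(x in S0 F d) `|N s x| ^+ 2.
  apply: (le_trans (cauchy_schwarz_card A (N s))); rewrite ler_wpM2l //.
  rewrite [leRHS](bigID (mem A)) /= [X in _ <= X + _](eq_bigl [in A]) => [|x]; last first.
    by apply/andP/idP => [[]//|Ax]; split=> //; apply: sA.
  by rewrite lerDl; apply: sumr_ge0 => t _; rewrite exprn_ge0.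
apply: (@le_trans _ _ (q * \sum_(s | s != 0) #|A|%:R * \sum_(x in S0 F d) `|N s x| ^+ 2)).
  by rewrite ler_wpM2l // ler_sum.
rewrite -mulr_sumr [leLHS]mulrCA ler_wpM2l //.
have -> : q * \sum_(s | s != 0) \sum_(x in S0 F d) `|N s x| ^+ 2 =
    \sum_(b in B) \sum_(c in B) ((sqnorm b - sqnorm c == 0)%:R * q - 1) *
      ((b - c == 0)%:R * q ^+ d - q ^+ m * ((sqnorm (b - c) == 0)%:R * q - 1)).
  transitivity (\sum_(s | s != 0) \sum_(b in B) \sum_(c in B)
      e (s * (sqnorm b - sqnorm c)) *
      (q * \sum_(x in S0 F d) e (dotp ((- 2 * s) *: (b - c)) x))).
    rewrite mulr_sumr; apply: eq_bigr => s _; rewrite mulr_sumr.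
    under eq_bigr do rewrite (sqr_norm_char_sum he) mulr_sumr.
    rewrite exchange_big; apply: eq_bigr => b _ /=.
    under eq_bigr do rewrite mulr_sumr.
    rewrite exchange_big; apply: eq_bigr => c _ /=.
    rewrite mulr_sumr mulr_sumr; apply: eq_bigr => x; rewrite inE => /eqP x0.
    rewrite mulrCA -eD !sqnormB x0 dotpZl (dotpC _ x) dotpBr; congr (_ * e _).
    by ring.
  rewrite exchange_big; apply: eq_bigr => b _ /=.
  rewrite exchange_big; apply: eq_bigr => c _ /=.
  rewrite -(char_sumM_neq0 he) mulr_suml; apply: eq_bigr => s ns; congr (_ * _).
  (* Whether [(- 2 * s) *: (b - c)] is zero or isotropic does not depend on [s], so this factor
     leaves the sum over [s]. *)
  have n2s : - 2 * s != 0 by rewrite mulNr oppr_eq0 mulf_neq0 ?natf2_neq0.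
  rewrite (cone_fourier F3 he dE om) scaler_eq0 (negPf n2s) sqnormZ.
  by rewrite [_ * sqnorm _ == 0]mulf_eq0 expf_eq0 (negPf n2s).
have qm_ge0 : 0 <= q ^+ m by rewrite exprn_ge0.
have qd_ge0 : 0 <= q ^+ d by rewrite exprn_ge0.
(* Off the diagonal a term is [- q ^+ m] times two factors, each [q - 1] or [-1]. It is at most
   [q ^+ m * (q - 1)]; when both factors are [q - 1] the minus sign saves a loss of order
   [q ^+ m.+2]. *)
apply: (@le_trans _ _ (\sum_(b in B) \sum_(c in B) ((c == b)%:R * q ^+ d.+1 + q ^+ m.+1))).
  apply: ler_sum => b _; apply: ler_sum => c _; rewrite !exprS.
  rewrite -subr_ge0 (eq_sym c) -(subr_eq0 b c).
  have [bc0|_] := eqVneq (b - c) 0.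
    have /eqP -> : b == c by rewrite -subr_eq0 bc0.
    rewrite subrr subrr sqnorm0 eqxx !mul1r.
    rewrite (_ : _ - _ = q ^+ d + q * q ^+ m + q ^+ m * (q - 1) ^+ 2); last by ring.
    by rewrite !addr_ge0 ?mulr_ge0 ?exprn_ge0 ?subr_ge0.
  rewrite !mul0r; set i := _ == 0; set j := _ == 0.
  rewrite (_ : _ - _ = q ^+ m * (q + (i%:R * q - 1) * (j%:R * q - 1))); last by ring.
  rewrite mulr_ge0 //; case: i; case: j; rewrite ?mul1r ?mul0r ?add0r.
  - by rewrite addr_ge0 // mulr_ge0 ?subr_ge0.
  - by rewrite mulrN1 opprB addrC subrK.
  - by rewrite mulN1r opprB addrC subrK.
  - by rewrite mulrNN mulr1 addr_ge0.
rewrite le_eqVlt; apply/orP; left; apply/eqP.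
rewrite expr2 [in RHS]mulrA -mulrDl mulr_natr -sumr_const; apply: eq_bigr => b Bb.
rewrite big_split /= sumr_const -mulr_suml mulr_natr; congr (_ + _).
rewrite (bigD1 b) //= eqxx big1 ?addr0 ?mul1r // => c /andP[_ /negPf ->] //.
Qed.

(** * Mass of Fourier transforms on spheres *)

Definition sphere_mass A (r : F) : algC :=
  \sum_(x | sqnorm x == r) `|\sum_(a in A) e (dotp x a)| ^+ 2.

Lemma sphere_mass_ge0 A r : 0 <= sphere_mass A r.
Proof. by apply: sumr_ge0 => x _; rewrite exprn_ge0. Qed.

Lemma sum_sphere_mass A : \sum_r sphere_mass A r = q ^+ d * #|A|%:R.
Proof.
by rewrite -(parseval_set he) (partition_big (@sqnorm F d) xpredT).
Qed.

Lemma sphere_massE A r :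
  q * sphere_mass A r = q ^+ d * #|A|%:R - q ^+ m * \sum_(a in A) \sum_(b in A)
      \sum_(s | s != 0) e (- (s * r) - sqnorm (a - b) / (4 * s)).
Proof.
rewrite /sphere_mass; under eq_bigr do rewrite (sqr_norm_char_sum he).
rewrite exchange_big mulr_sumr mulr_natr -sumr_const [X in _ - X]mulr_sumr -sumrB.
apply: eq_bigr => a Aa; rewrite exchange_big /= mulr_sumr.
transitivity (\sum_(b in A) ((b == a)%:R * q ^+ d
    - q ^+ m * \sum_(s | s != 0) e (- (s * r) - sqnorm (a - b) / (4 * s)))).
  apply: eq_bigr => b Ab; rewrite (eq_sym b) -(subr_eq0 a).
  rewrite -(sphere_fourier F3 he dE om); congr (_ * _); apply: eq_bigr => x _.
  by rewrite -dotpBr dotpC.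
rewrite big_split /= sumrN -mulr_sumr; congr (_ - _).
rewrite -mulr_suml (bigD1 a) //= eqxx big1 ?addr0 ?mul1r // => b.
by case/andP => _ /negPf ->.
Qed.

(** For [r = 0] the inner sum over [s] is at least -1, so each pair of points of [A] adds at most
    [q ^+ m]. *)
Lemma sphere_mass0_le A :
  q * sphere_mass A 0 <= q ^+ d * #|A|%:R + q ^+ m * #|A|%:R ^+ 2.
Proof.
rewrite sphere_massE lerD2l -mulrN ler_wpM2l ?exprn_ge0 //.
rewrite expr2 mulr_natr -sumr_const -sumrN; apply: ler_sum => a _.
rewrite -sumr_const -sumrN; apply: ler_sum => b _.
have -> : \sum_(s | s != 0) e (- (s * 0) - sqnorm (a - b) / (4 * s)) =
    \sum_(s | s != 0) e (s * - (sqnorm (a - b) / 4)).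
  rewrite -[RHS]sum_inv_neq0; apply: eq_bigr => s ns; congr e.
  by rewrite mulr0 oppr0 add0r; field; rewrite ns natf4_neq0.
rewrite (char_sumM_neq0 he) opprB gerBl mulr_ge0 //; exact: ler0n.
Qed.

(* For [r != 0] the phases [e (s * r)] cancel along each punctured line, so that
   only the pairs [a = b] contribute positively. *)
Let phase_sum r (a b : 'rV[F]_d) : algC := \sum_(s | s != 0) \sum_(t | t != 0)
  e (- (s * r) - - (t * r)) * ((2 * s)^-1 *: a - (2 * t)^-1 *: b == 0)%:R.

Let phase_sum_le r a b : r != 0 -> phase_sum r a b <= (b == a)%:R * q.
Proof.
move=> nr; have n2 := natf2_neq0 F3.
(* Every indicator vanishes unless [b] is a nonzero multiple of [a]. *)
have [|noprop] := boolP [exists c : F, (c != 0) && (b == c *: a)]; last first.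
  rewrite /phase_sum big1 ?mulr_ge0 ?ler0n // => s ns; rewrite big1 // => t nt.
  case: eqP => [/eqP|]; rewrite ?mulr0 // subr_eq0 => /eqP ab.
  case/negP: noprop; apply/existsP; exists (t / s); rewrite mulf_neq0 ?invr_eq0 //=.
  apply/eqP; rewrite -[b](scale1r) -[1](divff (mulf_neq0 n2 nt)) -scalerA -ab scalerA.
  by congr (_ *: _); field; rewrite ns n2.
case/existsP => c /andP[nc /eqP ->{b}].
(* If [a = 0], all indicators are 1 and the sum is a product of two sums equal to -1. *)
have [->|na] := eqVneq a 0.
  rewrite scaler0 eqxx mul1r /phase_sum.
  under eq_bigr do under eq_bigr do rewrite !scaler0 subrr eqxx mulr1 eD opprK mulrC.
  under eq_bigr do rewrite -mulr_suml (char_sumM_neq0 he) (negPf nr) mul0r sub0r.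
  rewrite -mulr_sumr.
  under eq_bigr do rewrite -mulrN.
  by rewrite (char_sumM_neq0 he) oppr_eq0 (negPf nr) mul0r sub0r mulrNN mulr1.
(* The indicator forces [t = c * s]; the remaining sum is [q - 1] if [c = 1] and -1 otherwise. *)
have -> : phase_sum r a (c *: a) = \sum_(s | s != 0) e (s * ((c - 1) * r)).
  apply: eq_bigr => s ns; rewrite (bigD1 (c * s)) ?mulf_neq0 //=.
  rewrite big1 => [|t /andP[nt ntcs]].
    rewrite addr0 scalerA -scalerBl (_ : (2 * s)^-1 - _ = 0) ?scale0r ?eqxx ?mulr1.
      by congr e; ring.
    by field; rewrite n2 ns nc.
  rewrite scalerA -scalerBl scaler_eq0 (negPf na) orbF.
  rewrite (_ : (2 * s)^-1 - _ = (t - c * s) / (2 * s * t)); last by field; rewrite n2 ns nt.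
  by rewrite !mulf_eq0 subr_eq0 (negPf ntcs) invr_eq0 !mulf_eq0 (negPf n2) (negPf ns) (negPf nt) mulr0.
rewrite (char_sumM_neq0 he) mulf_eq0 (negPf nr) orbF subr_eq0.
have -> : (c *: a == a) = (c == 1).
  by rewrite -subr_eq0 -{2}(scale1r a) -scalerBl scaler_eq0 (negPf na) orbF subr_eq0.
by rewrite gerBl.
Qed.

(* Each inner sum over [s] is a Kloosterman sum. Weil's bound is avoided by
   summing over the whole cone after Cauchy-Schwarz: the diagonal terms of the
   squared kernel are controlled by [phase_sum_le], and by the sign in
   [cone_fourier] each pair [a, b] adds at most [q ^+ m] to the rest. *)
Lemma cone_kernel_le A r : r != 0 -> A \subset S0 F d ->
  q * `|\sum_(a in A) \sum_(b in A) \sum_(s | s != 0)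
         e (- (s * r) - sqnorm (a - b) / (4 * s))| ^+ 2
    <= #|A|%:R * (q ^+ d.+1 * #|A|%:R + q ^+ m * #|A|%:R ^+ 2).
Proof.
move=> nr /subsetP sA; have n2 := natf2_neq0 F3; have n4 := natf4_neq0 F3.
(* An index is a pair (a, s). For isotropic [a] and [x], the phase [- sqnorm (a - x) / (4 * s)]
   equals [dotp (u (a, s)) x], which is linear in [x]. *)
pose P (i : 'rV[F]_d * F) := (i.1 \in A) && (i.2 != 0).
pose u (i : 'rV[F]_d * F) := (2 * i.2)^-1 *: i.1.
pose h x := \sum_(i | P i) e (- (i.2 * r) + dotp (u i) x).
have -> : \sum_(a in A) \sum_(b in A) \sum_(s | s != 0)
    e (- (s * r) - sqnorm (a - b) / (4 * s)) = \sum_(x in A) h x.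
  rewrite exchange_big; apply: eq_bigr => x Ax /=; rewrite pair_big_dep /=.
  apply: eq_bigr => -[a s] /andP[/= Aa ns]; congr e; congr (_ + _).
  have /eqP a0 : sqnorm a == 0 by have := sA _ Aa; rewrite inE.
  have /eqP x0 : sqnorm x == 0 by have := sA _ Ax; rewrite inE.
  by rewrite sqnormB a0 x0 dotpZl /=; field; rewrite n2 n4 ns.
apply: (@le_trans _ _ (#|A|%:R * (q * \sum_(x in S0 F d) `|h x| ^+ 2))).
  rewrite [leRHS]mulrCA ler_wpM2l //; apply: (le_trans (cauchy_schwarz_card A h)).
  rewrite ler_wpM2l ?ler0n // [leRHS](bigID (mem A)) /=.
  rewrite [X in _ <= X + _](eq_bigl [in A]) => [|x]; last first.
    by apply/andP/idP => [[]//|Ax]; split=> //; apply: sA.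
  by rewrite lerDl; apply: sumr_ge0 => t _; rewrite exprn_ge0.
rewrite ler_wpM2l ?ler0n //.
have -> : q * \sum_(x in S0 F d) `|h x| ^+ 2 = \sum_(a in A) \sum_(b in A)
    (q ^+ d * phase_sum r a b - q ^+ m * ((dotp a b == 0)%:R * q - 1)).
  under eq_bigr do rewrite (sqr_norm_char_sum he).
  rewrite exchange_big /= mulr_sumr.
  transitivity (\sum_(i | P i) \sum_(j | P j) e (- (i.2 * r) - - (j.2 * r)) *
     ((u i - u j == 0)%:R * q ^+ d - q ^+ m * ((dotp i.1 j.1 == 0)%:R * q - 1))).
    apply: eq_bigr => i /andP[Ai ni]; rewrite exchange_big /= mulr_sumr.
    apply: eq_bigr => j /andP[Aj nj].
    have /eqP i0 : sqnorm i.1 == 0 by have := sA _ Ai; rewrite inE.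
    have /eqP j0 : sqnorm j.1 == 0 by have := sA _ Aj; rewrite inE.
    (* Isotropy of [u i - u j] amounts to orthogonality of [i.1] and [j.1], so the correction term
       depends on neither [s] nor [t]. *)
    have -> : (dotp i.1 j.1 == 0) = (sqnorm (u i - u j) == 0).
      have uu : dotp (u i) (u j) = (2 * i.2)^-1 * ((2 * j.2)^-1 * dotp i.1 j.1).
        by rewrite dotpZl dotpC dotpZl dotpC.
      rewrite sqnormB uu !sqnormZ i0 j0 !mulr0 addr0 sub0r oppr_eq0.
      by rewrite !mulf_eq0 !invr_eq0 !mulf_eq0 (negPf n2) (negPf ni) (negPf nj).
    rewrite -(cone_fourier F3 he dE om) [RHS]mulrCA; congr (_ * _).
    rewrite mulr_sumr; apply: eq_bigr => x _; rewrite -eD; congr e.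
    by rewrite dotpBl; ring.
  rewrite -(pair_big [in A] (fun s => s != 0) (fun a s => \sum_(j | P j)
     e (- (s * r) - - (j.2 * r)) * ((u (a, s) - u j == 0)%:R * q ^+ d
        - q ^+ m * ((dotp a j.1 == 0)%:R * q - 1)))) /=.
  apply: eq_bigr => a Aa.
  transitivity (\sum_(s | s != 0) \sum_(b in A) \sum_(t | t != 0)
     e (- (s * r) - - (t * r)) * ((u (a, s) - u (b, t) == 0)%:R * q ^+ d
        - q ^+ m * ((dotp a b == 0)%:R * q - 1))).
    by apply: eq_bigr => s ns; rewrite pair_big.
  rewrite exchange_big; apply: eq_bigr => b Ab /=.
  set D := q ^+ m * _.
  transitivity (\sum_(s | s != 0) \sum_(t | t != 0)
     (q ^+ d * (e (- (s * r) - - (t * r)) * (u (a, s) - u (b, t) == 0)%:R)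
        - D * e (- (s * r) - - (t * r)))).
    by apply: eq_bigr => s ns; apply: eq_bigr => t nt; ring.
  under eq_bigr do rewrite sumrB -!mulr_sumr.
  rewrite sumrB -!mulr_sumr; congr (_ - _).
  (* The double sum of phases is the squared modulus of a punctured character sum equal to -1. *)
  rewrite -(sqr_norm_char_sum he (fun s => s != 0) (fun s => - (s * r))).
  under eq_bigr do rewrite -mulrN.
  by rewrite (char_sumM_neq0 he) oppr_eq0 (negPf nr) mul0r sub0r normrN1 expr1n mulr1.
apply: (@le_trans _ _ (\sum_(a in A) \sum_(b in A) ((b == a)%:R * q ^+ d.+1 + q ^+ m))).
  apply: ler_sum => a _; apply: ler_sum => b _; rewrite exprS.
  apply: lerD.
    by rewrite mulrA mulrC ler_wpM2r ?exprn_ge0 // phase_sum_le.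
  rewrite -[leRHS]mulr1 -mulrN ler_wpM2l ?exprn_ge0 // opprB gerBl.
  by rewrite mulr_ge0 ?ler0n.
rewrite le_eqVlt; apply/orP; left; apply/eqP.
rewrite expr2 [in RHS]mulrA -mulrDl mulr_natr -sumr_const; apply: eq_bigr => b Bb.
rewrite big_split /= sumr_const -mulr_suml mulr_natr; congr (_ + _).
by rewrite (bigD1 b) //= eqxx big1 ?addr0 ?mul1r // => c /andP[_ /negPf ->].
Qed.

Lemma sphere_mass_le A r : A \subset S0 F d -> #|A|%:R <= q ^+ m ->
  q * sphere_mass A r <= 3 * (q ^+ d * #|A|%:R).
Proof.
move=> sA leA.
have dX : q ^+ d = q ^+ m * q ^+ m by rewrite dE -addnn exprD.
have qm_ge0 : 0 <= q ^+ m by rewrite exprn_ge0.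
have qmA : q ^+ m * #|A|%:R ^+ 2 <= q ^+ d * #|A|%:R.
  by rewrite expr2 mulrA ler_wpM2r ?ler0n // dX ler_wpM2l.
have qdA : 0 <= q ^+ d * #|A|%:R by rewrite mulr_ge0 ?exprn_ge0 ?ler0n.
have [->|nr] := eqVneq r 0.
  apply: (le_trans (sphere_mass0_le A)).
  rewrite (_ : 3 * _ = q ^+ d * #|A|%:R + q ^+ d * #|A|%:R + q ^+ d * #|A|%:R); last by ring.
  by rewrite -addrA lerD2l (le_trans qmA) // lerDl.
have := cone_kernel_le nr sA; have := sphere_massE A r.
set T := (\sum_(a in A) _) => sE leT.
(* As [#|A|] is at most [q ^+ m], the second term of [leT] is at most the first; the factor 2 rounds
   up the square root of 2. The final constant is 3 = 1 + 2. *)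
have {}leT : `|T| <= 2 * (q ^+ m * #|A|%:R).
  rewrite -(@ler_pXn2r _ 2) // ?nnegrE ?normr_ge0 ?mulr_ge0 ?ler0n //.
  rewrite -(ler_pM2l q_gt0); apply: (le_trans leT).
  rewrite (_ : q * _ = #|A|%:R * (4 * (q * (q ^+ d * #|A|%:R)))); last by rewrite dX; ring.
  rewrite ler_wpM2l ?ler0n // exprS -mulrA.
  rewrite (_ : 4 * _ = q * (q ^+ d * #|A|%:R) + 3 * (q * (q ^+ d * #|A|%:R))); last by ring.
  rewrite lerD2l (le_trans qmA) // mulrA ler_peMl //.
  by rewrite mulr_ege1 // ler1n.
rewrite -[leLHS]ger0_norm ?mulr_ge0 ?sphere_mass_ge0 // sE.
apply: (le_trans (ler_normB _ _)); rewrite ger0_norm // normrM ger0_norm //.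
rewrite (_ : 3 * _ = q ^+ d * #|A|%:R + q ^+ m * (2 * (q ^+ m * #|A|%:R))).
  by rewrite lerD2l ler_wpM2l.
by rewrite dX; ring.
Qed.

(** [char_sum_sqnorm], read backwards, writes [e (s * sqnorm (a - b))] as a sum over [x] with
    quadratic coefficient -1/(4s). Grouping by [sqnorm x] allows Parseval in this coefficient, then
    Cauchy-Schwarz on each sphere. *)
Lemma dist_sum_sphere_mass A B :
  q ^+ d * \sum_(s | s != 0) `|dist_sum A B s| ^+ 2
    <= q * \sum_r sphere_mass A r * sphere_mass B r.
Proof.
have dX : q ^+ d = (q ^+ m) ^+ 2 by rewrite dE -muln2 exprM.
have n4 := natf4_neq0 F3.
pose f x := (\sum_(a in A) e (dotp x a)) * (\sum_(b in B) e (dotp x b))^*.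
pose H r := \sum_(x | sqnorm x == r) f x.
have NE s : s != 0 ->
    q ^+ m * dist_sum A B s = - \sum_r e (- (4 * s)^-1 * r) * H r.
  move=> ns; transitivity (- \sum_x e (- (4 * s)^-1 * sqnorm x) * f x); last first.
    congr (- _); rewrite (partition_big (@sqnorm F d) xpredT) //=.
    apply: eq_bigr => r _; rewrite mulr_sumr; apply: eq_bigr => x.
    by move/eqP => ->.
  transitivity (- \sum_(a in A) \sum_(b in B) \sum_x
      e (- (4 * s)^-1 * sqnorm x + dotp (a - b) x)).
    rewrite -[RHS]mulN1r !mulr_sumr; apply: eq_bigr => a _.
    rewrite !mulr_sumr; apply: eq_bigr => b _.
    rewrite (char_sum_sqnorm F3 he dE om); last by rewrite oppr_eq0 invr_eq0 mulf_neq0.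
    rewrite mulN1r mulNr opprK -/q; congr (_ * e _).
    have -> : 4 * - (4 * s)^-1 = - s^-1 by field; rewrite ns n4.
    by rewrite invrN invrK mulrN opprK mulrC.
  congr (- _).
  under eq_bigr do rewrite exchange_big.
  rewrite exchange_big; apply: eq_bigr => x _ /=.
  rewrite /f mulr_suml mulr_sumr; apply: eq_bigr => a _.
  rewrite rmorph_sum !mulr_sumr; apply: eq_bigr => b _ /=.
  by rewrite -eN -!eD dotpC dotpBr.
have -> : q ^+ d * \sum_(s | s != 0) `|dist_sum A B s| ^+ 2 =
    \sum_(s | s != 0) `|\sum_r e (- (4 * s)^-1 * r) * H r| ^+ 2.
  rewrite mulr_sumr; apply: eq_bigr => s /NE Ns; rewrite -[in RHS]normrN -Ns normrM exprMn.
  by rewrite [`|q ^+ m|]ger0_norm ?exprn_ge0 // dX.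
have hinj : injective (fun s : F => - (4 * s)^-1).
  by move=> s t /oppr_inj /invr_inj /(mulfI n4).
pose G u := `|\sum_r e (u * r) * H r| ^+ 2.
have -> : \sum_(s | s != 0) `|\sum_r e (- (4 * s)^-1 * r) * H r| ^+ 2 =
    \sum_(u | u != 0) G u.
  rewrite [RHS](reindex_inj hinj) /=; apply: eq_bigl => s.
  by rewrite oppr_eq0 invr_eq0 mulf_eq0 (negPf n4).
(* Adding the nonnegative term [u = 0] completes the sum for Parseval. *)
apply: (@le_trans _ _ (\sum_u G u)).
  by rewrite [leRHS](bigD1 0) //= lerDr exprn_ge0.
rewrite (char_parseval he) ler_wpM2l // ler_sum // => r _.
have := cauchy_schwarz (fun x => sqnorm x == r) (fun x : 'rV_d => \sum_(a in A) e (dotp x a))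
  (fun x => (\sum_(b in B) e (dotp x b))^*).
by under [X in _ <= _ * X]eq_bigr do rewrite norm_conjC.
Qed.

End Space.
End DistanceSums.

(** * From distance sums to the number of distances *)

Section Bound.
Variables (F : finFieldType) (d m : nat).
Hypotheses (F3 : (#|F| %% 4 = 3)%N) (dE : d = m.*2) (om : odd m).
Implicit Types A B : {set 'rV[F]_d}.

(** The terms [s != 0] add at most 17/16 of the term [s = 0], and 1 + 17/16 is below 3. *)
Lemma card_Delta_of_dist_sum (e : F -> algC) A B : additive_character e ->
  (0 < #|A| * #|B|)%N -> (16 * #|F| ^ d <= #|A| * #|B|)%N ->
  \sum_(s | s != 0) `|dist_sum e A B s| ^+ 2
    <= 17 * (#|F|%:R ^+ d * (#|A|%:R * #|B|%:R)) ->
  (#|F| <= 3 * #|Delta A B|)%N.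
Proof.
move=> he AB0 AB Z.
have := card_Delta_dist_sum he A B; rewrite (bigD1 0) //=.
have -> : dist_sum e A B 0 = (#|A| * #|B|)%:R.
  rewrite /dist_sum natrM mulr_natl -sumr_const; apply: eq_bigr => a _.
  by rewrite -sumr_const; apply: eq_bigr => b _; rewrite mul0r char0.
rewrite ger0_norm ?ler0n // -natrM => H.
move: Z; rewrite -natrM -natrX -natrM -natrM => Z.
have {Z}H := le_trans H (ler_wpM2l (ler0n _ _) (lerD (lexx _) Z)).
move: H; rewrite -!natrX -natrD -!natrM ler_nat => H.
rewrite -(@leq_pmul2r ((#|A| * #|B|) ^ 2)) ?expn_gt0 ?AB0 //.
apply: (leq_trans H); move: AB; set X := (#|A| * #|B|)%N; set Y := (_ ^ d)%N.
by rewrite (mulnC 3) -mulnA leq_mul2l => AB; apply/orP; right; nia.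
Qed.

Lemma card_Delta_small A B : A \subset S0 F d -> (#|A| <= #|F| ^ m)%N ->
  (16 * #|F| ^ d <= #|A| * #|B|)%N -> (#|F| <= 3 * #|Delta A B|)%N.
Proof.
move=> sA leA AB; have [e he] := additive_character_exists F.
have F0 : (0 < #|F|)%N by apply/card_gt0P; exists 0.
have q0 : 0 < #|F|%:R :> algC by rewrite ltr0n.
apply: (card_Delta_of_dist_sum he) => //.
  by apply: leq_trans AB; rewrite muln_gt0 expn_gt0 F0.
rewrite -(ler_pM2l (exprn_gt0 d q0)).
apply: (le_trans (dist_sum_sphere_mass F3 he dE om A B)).
(* The mass of [A] is bounded on each sphere, that of [B] only in total, by Parseval. *)
apply: (@le_trans _ _ (3 * (#|F|%:R ^+ d * #|A|%:R) * \sum_r sphere_mass e B r)).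
  rewrite !mulr_sumr; apply: ler_sum => r _; rewrite mulrA ler_wpM2r ?sphere_mass_ge0 //.
  by rewrite (sphere_mass_le F3 he dE om) // -natrX ler_nat.
rewrite (sum_sphere_mass he).
rewrite (_ : 3 * _ * _ =
  3 * (#|F|%:R ^+ d * (#|F|%:R ^+ d * (#|A|%:R * #|B|%:R)))); last by ring.
rewrite [leRHS]mulrCA ler_wpM2r ?ler_nat //.
by rewrite !mulr_ge0 ?exprn_ge0 ?ler0n.
Qed.

Lemma card_Delta_large A B : A \subset S0 F d -> (#|F| ^ m <= #|A|)%N ->
  (16 * #|F| ^ d <= #|A| * #|B|)%N -> (#|F| <= 3 * #|Delta A B|)%N.
Proof.
move=> sA leA AB; have [e he] := additive_character_exists F.
have F0 : (0 < #|F|)%N by apply/card_gt0P; exists 0.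
have q0 : 0 < #|F|%:R :> algC by rewrite ltr0n.
have dX : (#|F| ^ d = #|F| ^ m * #|F| ^ m)%N by rewrite dE -addnn expnD.
(* If [B] is too large, any [16 * #|F| ^ m] of its points suffice: [#|A|] is at least [#|F| ^ m], so
   the product stays above [16 * #|F| ^ d]. *)
have [C sC [CB AC]] : exists2 C : {set 'rV[F]_d}, C \subset B &
    (#|C| <= 16 * #|F| ^ m)%N /\ (16 * #|F| ^ d <= #|A| * #|C|)%N.
  have [leB|ltB] := leqP #|B| (16 * #|F| ^ m); first by exists B.
  exists [set x in take (16 * #|F| ^ m) (enum B)].
    by apply/subsetP => x; rewrite inE => /mem_take; rewrite mem_enum.
  have -> : #|[set x in take (16 * #|F| ^ m) (enum B)]| = (16 * #|F| ^ m)%N.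
    rewrite cardsE (card_uniqP _) ?take_uniq ?enum_uniq // size_take -cardE.
    by rewrite ltB.
  by split=> //; rewrite dX mulnCA leq_mul2r leA orbT.
apply: (@leq_trans (3 * #|Delta A C|)); last first.
  by rewrite leq_mul2l subset_leq_card // imset2S.
apply: (card_Delta_of_dist_sum he) => //.
  by apply: leq_trans AC; rewrite muln_gt0 expn_gt0 F0.
rewrite -(ler_pM2l q0).
apply: (le_trans (dist_sum_le_right F3 he dE om C sA)).
suff : (#|A| * (#|F| ^ d.+1 * #|C| + #|F| ^ m.+1 * #|C| ^ 2) <=
    #|F| * (17 * (#|F| ^ d * (#|A| * #|C|))))%N.
  by rewrite -(ler_nat algC) !(natrM, natrD, natrX).
rewrite !expnS expn0 muln1 dX; set Q := (#|F| ^ m)%N in CB *; set f := #|F|.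
(* 17 = 1 + 16, where 16 comes from the bound on [#|C|]. *)
have -> : (f * (17 * (Q * Q * (#|A| * #|C|))) =
   #|A| * (f * (Q * Q) * #|C| + f * Q * (#|C| * (16 * Q))))%N by ring.
by rewrite leq_mul2l leq_add2l !leq_mul2l CB !orbT.
Qed.
End Bound.
End DistanceSets.

Theorem theorem1p21 (F : finFieldType) (q p n k : nat)
  (Hq : #|F| = q) (Hp : prime p) (Hpodd : odd p) (Hn : 0 < n) (Hqpn : q = p ^ n)
  (Hq4 : q %% 4 = 3) (Hk : 0 < k)
  (A B : {set 'rV[F]_(4 * k + 2)})
  (HA : A \subset S0 F (4 * k + 2))
  (HAB : 16 * q ^ (4 * k + 2) <= #|A| * #|B|)
  (Hsize : (#|A| ^ 2 <= q ^ (4 * k + 2 - 1)) \/ (q ^ ((4 * k + 2) %/ 2) <= #|A|)) :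
  q <= 144 * #|Delta A B|.
Proof.
have dE : 4 * k + 2 = (2 * k + 1).*2 by lia.
(* The dimension is 2 mod 4, so its half is odd: this is the source of the minus type. *)
have om : odd (2 * k + 1) by rewrite oddD oddM.
subst q; apply: (@leq_trans (3 * #|Delta A B|)); last by rewrite leq_mul2r orbT.
have [leA|/ltnW leA] := leqP #|A| (#|F| ^ (2 * k + 1)).
  exact: (card_Delta_small Hq4 dE om).
exact: (card_Delta_large Hq4 dE om).
Qed.
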